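(* Let $G$ be a finitely presented group with finite presentation $G=\langle A\mid R\rangle$. Then there is a non-deterministic two-tape Turing machine $M$ such that the space function of $M$ is equivalent to the space function $S_G$ of $G$, and the language accepted by $M$ coincides with the set of words (over $A^{\pm1}$) equal to $1$ in the group $G$.
   Context: Space function of a group. Let $G=\langle A\mid R\rangle$ be a finite presentation; words are words over $A^{\pm1}$ and $||w||$ is the number of letters of $w$. For a finite sequence of words $W=(w_1,\dots,w_s)$ put $||W||=\sum_i||w_i||$. An elementary $R$-transformation of $W$ does one of the following to some $w_i$: inserts or removes a subword $aa^{-1}$ ($a\in A^{\pm1}$); inserts or removes a subword $r$ or $r^{-1}$ ($r\in R$); replaces $w_i$ by a cyclic conjugate (cyclic shift); if $w_i\equiv uv$, replaces the entry $w_i$ by the two entries $u,v$; removes $w_i$ from the sequence if it is the empty word. The space of a rewriting $W_0\to\dots\to W_t$ is $\max_{j}||W_j||$. For a word $w$ equal to $1$ in $G$, $space_G(w)$ is the minimum of the spaces of all rewritings starting with $(w)$ and ending with the empty sequence $(\,)$. The space function is $S_G(n)=\max\{space_G(w): w=1\text{ in }G,\ ||w||\le n\}$; up to the equivalence below it does not depend on the finite presentation. Equivalence. For non-decreasing functions on $\mathbb N$, $f\preceq g$ means there is a positive integer $c$ with $f(n)\le cg(cn)+cn$ for all $n\in\mathbb N$; $f\sim g$ ($f$ and $g$ are equivalent) means $f\preceq g$ and $g\preceq f$. Space function of a Turing machine $M$. The space of a computation is the maximum, over its configurations, of the total number of tape letters on all tapes. For an accepted input word $u$, $space_M(u)$ is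 the minimum of the spaces of accepting computations starting from the input configuration of $u$. The space function is $S_M(n)=\max\{space_M(u): u \text{ accepted by } M,\ ||u||\le n\}$. (Not counting the letters on the input tape would give an equivalent function.) *)

(* Defs.v *)
From mathcomp Require Import all_boot.
From mathcomp Require Import boolp classical_sets.

Set Implicit Arguments.
Unset Strict Implicit.
Unset Printing Implicit Defensive.

Local Open Scope nat_scope.

(** * Functions up to equivalence *)

Definition fpreceq (f g : nat -> nat) : Prop :=
  exists c, 0 < c /\ forall n, f n <= c * g (c * n) + c * n.

Definition fequiv (f g : nat -> nat) : Prop := fpreceq f g /\ fpreceq g f.

(** * Space of runs of a transition system *)

(* The least element of [P], and 0 if [P] is empty. *)
Definition least (P : nat -> Prop) : nat :=
  xget 0 [set n | P n /\ forall m, P m -> n <= m]%classic.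

(* [is_run step final x p]: the list [x :: p] is a finite sequence of states,
   each obtained from the previous one by [step], and ending in [final]. *)
Definition is_run (T : Type) (step : T -> T -> Prop) (final : T -> Prop)
    (x : T) (p : seq T) : Prop :=
  path (fun y z => `[< step y z >]) x p /\ final (last x p).

Definition run_space (T : Type) (weight : T -> nat) (x : T) (p : seq T) : nat :=
  \max_(y <- x :: p) weight y.

Definition min_space (T : Type) (step : T -> T -> Prop) (final : T -> Prop)
    (weight : T -> nat) (x : T) : nat :=
  least (fun s => exists p, is_run step final x p /\ s = run_space weight x p).

(** * Presentations *)

(* A letter of A^{+-1}: [(a, false)] stands for a and [(a, true)] for a^-1. *)
Definition letter (A : finType) : finType := (A * bool)%type.
Definition word (A : finType) : Type := seq (letter A).

Definition inv_letter (A : finType) (x : letter A) : letter A := (x.1, ~~ x.2).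
Definition inv_word (A : finType) (w : word A) : word A :=
  rev (map (@inv_letter A) w).

Section Presentation.
Variables (A : finType) (R : seq (word A)).

(* The congruence on words whose quotient is the group <A | R>. *)
Inductive pres_eq : word A -> word A -> Prop :=
| pres_refl u : pres_eq u u
| pres_sym u v : pres_eq u v -> pres_eq v u
| pres_trans u v w : pres_eq u v -> pres_eq v w -> pres_eq u w
| pres_cat u u' v v' : pres_eq u u' -> pres_eq v v' -> pres_eq (u ++ v) (u' ++ v')
| pres_cancel a : pres_eq [:: a; inv_letter a] [::]
| pres_relator r : r \in R -> pres_eq r [::].

Definition word_eval (G : groupType) (gen : A -> G) (w : word A) : G :=
  (\prod_(x <- w) (if x.2 then (gen x.1)^-1 else gen x.1))%g.

Definition is_presentation (G : groupType) (gen : A -> G) : Prop :=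
  (forall g, exists w, word_eval gen w = g) /\
  (forall u v, word_eval gen u = word_eval gen v <-> pres_eq u v).

(** * Space function of a presentation *)

(* The subwords that an elementary transformation may insert or remove. *)
Inductive elem_word : word A -> Prop :=
| elem_cancel a : elem_word [:: a; inv_letter a]
| elem_relator r : r \in R -> elem_word r
| elem_relator_inv r : r \in R -> elem_word (inv_word r).

(* One word of the sequence is replaced by a (possibly empty) list of words. *)
Inductive elem_replace : word A -> seq (word A) -> Prop :=
| elem_insert u v e : elem_word e -> elem_replace (u ++ v) [:: u ++ e ++ v]
| elem_remove u v e : elem_word e -> elem_replace (u ++ e ++ v) [:: u ++ v]
| elem_shift u v : elem_replace (u ++ v) [:: v ++ u]
| elem_split u v : elem_replace (u ++ v) [:: u; v]
| elem_discard : elem_replace [::] [::].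

Inductive elem_step : seq (word A) -> seq (word A) -> Prop :=
| ElemStep W1 w ws W2 :
    elem_replace w ws -> elem_step (W1 ++ w :: W2) (W1 ++ ws ++ W2).

Definition seq_length (W : seq (word A)) : nat := \sum_(w <- W) size w.

Definition word_space (w : word A) : nat :=
  min_space elem_step (fun W => W = [::]) seq_length [:: w].

Definition group_space_function (G : groupType) (gen : A -> G) (n : nat) : nat :=
  \max_(w : n.-bseq (letter A) | `[< word_eval gen w = 1%g >]) word_space w.

End Presentation.

(** * Multi-tape Turing machines *)

(* The configuration u q v of a tape: [u] is the word to the left of the head,
   [v] the word to its right.  The tape has no blank cells: it consists of the
   squares of [u] and [v], delimited by two end markers. *)
Record tape_config (Y Q : Type) := TapeConfig {
  tape_left : seq Y;
  tape_state : Q;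
  tape_right : seq Y
}.

Definition tape_size (Y Q : Type) (c : tape_config Y Q) : nat :=
  size (tape_left c) + size (tape_right c).

(* The instruction u q v -> u' q' v' for one tape.  If [at_left_end] (resp.
   [at_right_end]) holds, both sides moreover start with the left (resp. end
   with the right) end marker of the tape. *)
Record tape_command (Y Q : Type) := TapeCommand {
  at_left_end : bool;
  at_right_end : bool;
  cmd_from : tape_config Y Q;
  cmd_to : tape_config Y Q
}.

Definition tape_step (Y Q : Type) (t : tape_command Y Q)
    (c d : tape_config Y Q) : Prop :=
  exists x y : seq Y,
    [/\ at_left_end t -> x = [::],
        at_right_end t -> y = [::],
        c = TapeConfig (x ++ tape_left (cmd_from t)) (tape_state (cmd_from t))
                       (tape_right (cmd_from t) ++ y) &
        d = TapeConfig (x ++ tape_left (cmd_to t)) (tape_state (cmd_to t))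
                       (tape_right (cmd_to t) ++ y)].

(* Non-deterministic machine with [k] tapes (one head per tape) and input
   alphabet [I]; non-determinism means that several of the finitely many
   commands may be applicable to the same configuration. *)
Record turing_machine (I : finType) (k : nat) := TuringMachine {
  tm_letter : 'I_k -> finType;
  tm_state : 'I_k -> finType;
  tm_input_tape : 'I_k;
  tm_input_letter : I -> tm_letter tm_input_tape;
  tm_input_letter_inj : injective tm_input_letter;
  tm_command : finType;
  tm_action : tm_command ->
    forall i : 'I_k, tape_command (tm_letter i) (tm_state i);
  tm_start : forall i : 'I_k, tm_state i;
  tm_accept : forall i : 'I_k, tm_state i
}.

Section TuringMachine.
Variables (I : finType) (k : nat) (M : turing_machine I k).

Definition tm_config : Type :=
  forall i : 'I_k, tape_config (tm_letter M i) (tm_state M i).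

Definition tm_step (c d : tm_config) : Prop :=
  exists t : tm_command M, forall i, tape_step (tm_action t i) (c i) (d i).

Definition tm_accepting (c : tm_config) : Prop :=
  forall i, tape_state (c i) = tm_accept M i.

Definition tm_space (c : tm_config) : nat := \sum_(i < k) tape_size (c i).

(* The head stands at the right end of the input word; other tapes are empty. *)
Definition is_input_config (u : seq I) (c : tm_config) : Prop :=
  c (tm_input_tape M) =
    TapeConfig (map (@tm_input_letter I k M) u) (tm_start M (tm_input_tape M)) [::]
  /\ forall i, i != tm_input_tape M -> c i = TapeConfig [::] (tm_start M i) [::].

Definition tm_accepts (u : seq I) : Prop :=
  exists c p, is_input_config u c /\ is_run tm_step tm_accepting c p.

Definition tm_word_space (u : seq I) : nat :=
  least (fun s => exists c p, [/\ is_input_config u c,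
    is_run tm_step tm_accepting c p & s = run_space tm_space c p]).

(* The maximum over the empty set is 0. *)
Definition tm_space_function (n : nat) : nat :=
  \max_(u : n.-bseq I | `[< tm_accepts u >]) tm_word_space u.

End TuringMachine.

(* Main.v *)
(** A single working tape holding [w1 # w2 # ... ws #] imitates the elementary
    transformations directly: insertions, deletions, splittings and discarding
    of empty words are commands, and a cyclic shift carries one letter at a time
    from the beginning of a word to its end; the second tape is idle.  The
    letters of the sequence of words are those of the tape, up to the one letter
    being carried, so a computation yields a rewriting of at most one more unit
    of space.  Conversely, the marks [#] could outnumber the letters only because
    of empty words; discarding these immediately, a rewriting of space [s] is
    imitated in space [2 s + 2].  The additive constants are absorbed in the
    linear term of the equivalence except at [n = 0], where the machine accepts
    the empty tape at once. *)
Require Import Defs.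
From HB Require Import structures.
From mathcomp Require Import all_boot.
From mathcomp Require Import boolp classical_sets zify.

Set Implicit Arguments.
Unset Strict Implicit.
Unset Printing Implicit Defensive.

Local Open Scope nat_scope.

(** * Least values and bounded runs *)

Lemma leastP (P : nat -> Prop) m :
  P m -> P (least P) /\ forall k, P k -> least P <= k.
Proof.
move=> Pm.
have exP : exists k, `[< P k >] by exists m; apply/asboolP.
suff [] : [set n | P n /\ forall k, P k -> n <= k]%classic (least P) by [].
case: (ex_minnP exP) => k /asboolP Pk kmin.
by apply: (xgetPex 0); exists k; split=> // i Pi; apply/kmin/asboolP.
Qed.

Lemma least_le (P : nat -> Prop) m : P m -> least P <= m.
Proof. by move=> Pm; case: (leastP Pm) => _; apply. Qed.

Lemma least_in (P : nat -> Prop) : (exists m, P m) -> P (least P).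
Proof. by case=> m /leastP[]. Qed.

Section Reach.
Variables (T : Type) (step : T -> T -> Prop) (weight : T -> nat).

(** Unlike runs of minimal space, runs with a prescribed bound compose, and the bound can be
    enlarged at will. *)
Definition reach (B : nat) (x y : T) : Prop :=
  exists p, [/\ path (fun y z => `[< step y z >]) x p,
    run_space weight x p <= B & last x p = y].

Lemma run_space_cons x y p :
  run_space weight x (y :: p) = maxn (weight x) (run_space weight y p).
Proof. by rewrite /run_space big_cons. Qed.

Lemma reach_refl B x : weight x <= B -> reach B x x.
Proof. by move=> xB; exists [::]; split=> //; rewrite /run_space big_seq1. Qed.

Lemma reach_cons B x y z :
  weight x <= B -> step x y -> reach B y z -> reach B x z.
Proof.
move=> xB xy [p [p_path pB pz]]; exists (y :: p); split=> //=.
  by rewrite p_path andbT; apply/asboolP.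
by rewrite run_space_cons geq_max xB.
Qed.

Lemma reach_step B x y : weight x <= B -> weight y <= B -> step x y -> reach B x y.
Proof. by move=> xB yB xy; apply/(reach_cons xB xy)/reach_refl. Qed.

(** The remaining run [reach B y z] is kept beside the induction hypothesis because it also bounds
    the weight of [y]. *)
Lemma reach_ind B (Q : T -> T -> Prop) :
    (forall x, weight x <= B -> Q x x) ->
    (forall x y z, weight x <= B -> step x y -> reach B y z -> Q y z -> Q x z) ->
  forall x y, reach B x y -> Q x y.
Proof.
move=> Q0 QS x y [p]; elim: p x => [|x' p IHp] x [].
  by move=> _ xB <-; apply: Q0; rewrite /run_space big_seq1 in xB.
rewrite run_space_cons geq_max => /andP[/asboolP xx' p_path] /andP[xB pB] py.
by apply: (QS _ _ _ xB xx'); [exists p | apply: IHp].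
Qed.

Lemma reach_trans B x y z : reach B x y -> reach B y z -> reach B x z.
Proof.
move=> xy; elim/reach_ind: xy z => [//|x1 x2 x3 x1B x12 _ IH] z /IH.
exact: reach_cons.
Qed.

Lemma reach_le B B' x y : B <= B' -> reach B x y -> reach B' x y.
Proof. by move=> BB' [p [pp pB py]]; exists p; split=> //; apply: leq_trans BB'. Qed.

Lemma reach_weight B x y : reach B x y -> weight x <= B.
Proof. by case=> p []; rewrite /run_space big_cons geq_max => _ /andP[]. Qed.

Lemma min_space_le (final : T -> Prop) B x y :
  reach B x y -> final y -> min_space step final weight x <= B.
Proof.
case=> p [p_path pB py] fy; apply: leq_trans pB.
by apply: least_le; exists p; split=> //; split=> //; rewrite py.
Qed.

(** [least] is 0 on an empty set, so one run must be given before the minimum is known to be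
    attained. *)
Lemma min_space_reach (final : T -> Prop) x p : is_run step final x p ->
  exists2 y, final y & reach (min_space step final weight x) x y.
Proof.
move=> x_p.
have [|q [[q_path q_fin] minE]] := @least_in (fun s => exists q,
  is_run step final x q /\ s = run_space weight x q).
  by exists (run_space weight x p), p.
by exists (last x q) => //; exists q; split=> //; rewrite /min_space minE.
Qed.

End Reach.

(** A simulation in which a step may be matched by no step at all. The constant [k] is 1 from
    computations to rewritings (the carried letter) and 0 when the idle tape is added. *)
Lemma reach_simulation (T T' : Type) step (weight : T -> nat) step'
    (weight' : T' -> nat) (rel : T -> T' -> Prop) k :
    (forall x x', rel x x' -> weight' x' <= weight x + k) ->
    (forall x y x', step x y -> rel x x' ->
      exists2 y', rel y y' & x' = y' \/ step' x' y') ->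
  forall B x y x', reach step weight B x y -> rel x x' ->
  exists2 y', rel y y' & reach step' weight' (B + k) x' y'.
Proof.
move=> le_weight sim B x y x' xy.
elim/reach_ind: xy x' => [z zB|x1 x2 x3 x1B x12 _ IH] x' rel_x'.
  exists x' => //; apply: reach_refl.
  by apply: leq_trans (le_weight _ _ rel_x') _; rewrite leq_add2r.
have [x2' rel2 x'x2'] := sim _ _ _ x12 rel_x'.
have [y' rely' x2'y'] := IH _ rel2.
exists y' => //; case: x'x2' => [->//|x'x2']; apply: reach_cons x'x2' x2'y'.
by apply: leq_trans (le_weight _ _ rel_x') _; rewrite leq_add2r.
Qed.

(** * Words equal to 1 and rewriting to the empty sequence *)

Section Rewriting.
Variables (A : finType) (R : seq (word A)).

(** Induction on the derivation: both directions are proved together because of [pres_sym], in an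
    arbitrary context because of [pres_cat]. The size of [B] is irrelevant, only the existence of a
    rewriting is used. *)
Lemma pres_eq_rewrite u v : pres_eq R u v -> forall x y, exists B,
  reach (elem_step R) (@seq_length A) B [:: x ++ u ++ y] [:: x ++ v ++ y] /\
  reach (elem_step R) (@seq_length A) B [:: x ++ v ++ y] [:: x ++ u ++ y].
Proof.
have elemP e : elem_word R e -> forall x y, exists B,
    reach (elem_step R) (@seq_length A) B [:: x ++ e ++ y] [:: x ++ y] /\
    reach (elem_step R) (@seq_length A) B [:: x ++ y] [:: x ++ e ++ y].
  move=> elem_e x y; exists (maxn (seq_length [:: x ++ e ++ y]) (seq_length [:: x ++ y])).
  split; apply: reach_step; rewrite ?leq_maxl ?leq_maxr //.
    exact: (@ElemStep _ _ [::] _ _ [::] (elem_remove _ _ elem_e)).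
  exact: (@ElemStep _ _ [::] _ _ [::] (elem_insert _ _ elem_e)).
elim=> {u v} [u|u v _ IH|u v w _ IH1 _ IH2|u u' v v' _ IH1 _ IH2|a|r rR] x y.
- exists (seq_length [:: x ++ u ++ y]); split; exact: reach_refl.
- by have [B []] := IH x y; exists B.
- have [B1 [uv vu]] := IH1 x y; have [B2 [vw wv]] := IH2 x y.
  exists (maxn B1 B2); split; apply: reach_trans.
  + exact: reach_le (leq_maxl _ _) uv.
  + exact: reach_le (leq_maxr _ _) vw.
  + exact: reach_le (leq_maxr _ _) wv.
  + exact: reach_le (leq_maxl _ _) vu.
- have [B1 [uu' u'u]] := IH1 x (v ++ y); have [B2 [vv' v'v]] := IH2 (x ++ u') y.
  rewrite -!catA in vv' v'v *; exists (maxn B1 B2); split; apply: reach_trans.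
  + exact: reach_le (leq_maxl _ _) uu'.
  + exact: reach_le (leq_maxr _ _) vv'.
  + exact: reach_le (leq_maxr _ _) v'v.
  + exact: reach_le (leq_maxl _ _) u'u.
- exact: elemP (elem_cancel R a) x y.
- exact: elemP (elem_relator rR) x y.
Qed.

Variables (G : groupType) (gen : A -> G) (hG : is_presentation R gen).

Lemma word_eval_cat u v :
  word_eval gen (u ++ v) = (word_eval gen u * word_eval gen v)%g.
Proof. by rewrite /word_eval big_cat. Qed.

Lemma word_eval_nil : word_eval gen [::] = 1%g.
Proof. by rewrite /word_eval big_nil. Qed.

Lemma word_eval_inv u : word_eval gen (inv_word u) = (word_eval gen u)^-1%g.
Proof.
elim: u => [|a u IHu]; first by rewrite /inv_word /= word_eval_nil invg1.
rewrite /inv_word /= rev_cons -cats1 -[a :: u]cat1s !word_eval_cat invgM.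
congr (_ * _)%g; first exact: IHu.
by rewrite /word_eval !big_seq1 /=; case: a.2; rewrite /= ?invgK.
Qed.

Lemma word_eval_elem e : elem_word R e -> word_eval gen e = 1%g.
Proof.
have relE r : r \in R -> word_eval gen r = 1%g.
  by move=> rR; rewrite -word_eval_nil; apply/hG.2/pres_relator.
case=> [a|r /relE //|r /relE]; last by rewrite word_eval_inv => ->; rewrite invg1.
by rewrite -word_eval_nil; apply/hG.2/pres_cancel.
Qed.

(** Triviality is carried backwards along a rewriting, from the empty sequence, where it holds
    vacuously. *)
Lemma word_eval_step W W' : elem_step R W W' ->
  (forall w, w \in W' -> word_eval gen w = 1%g) ->
  forall w, w \in W -> word_eval gen w = 1%g.
Proof.
case=> W1 w ws W2 w_ws W'1 x; rewrite mem_cat inE => /or3P[xW1|/eqP->|xW2].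
- by apply: W'1; rewrite mem_cat xW1.
- have {}W'1 z : z \in ws -> word_eval gen z = 1%g.
    by move=> zws; apply: W'1; rewrite !mem_cat zws orbT.
  case: w_ws W'1 => {w ws} [u v e /word_eval_elem e1|u v e /word_eval_elem e1|u v|u v|] ws1.
  + by have := ws1 _ (mem_head _ _); rewrite !word_eval_cat e1 mul1g.
  + by have := ws1 _ (mem_head _ _); rewrite !word_eval_cat e1 mul1g.
  + have := ws1 _ (mem_head _ _); rewrite !word_eval_cat => vu1.
    (* A cyclic shift conjugates the value: $uv = v^{-1}(vu)v$. *)
    rewrite -(mulKg (word_eval gen v) (_ * _)%g) (mulgA (word_eval gen v)).
    by rewrite vu1 mul1g mulVg.
  + by rewrite word_eval_cat !ws1 ?mulg1 // !inE eqxx ?orbT.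
  + exact: word_eval_nil.
- by apply: W'1; rewrite !mem_cat xW2 !orbT.
Qed.

Lemma word_eval1P w : word_eval gen w = 1%g <->
  exists B, reach (elem_step R) (@seq_length A) B [:: w] [::].
Proof.
split=> [w1|[B w_nil]].
  have /pres_eq_rewrite/(_ [::] [::])[B []] : pres_eq R w [::].
    by apply/hG.2; rewrite word_eval_nil.
  rewrite /= !cats0 => w_nil _; exists B; apply: reach_trans w_nil _.
  apply: reach_step; rewrite /seq_length ?big_seq1 ?big_nil //.
  exact: (@ElemStep _ _ [::] _ _ [::] (elem_discard R)).
suff: forall W W', reach (elem_step R) (@seq_length A) B W W' -> W' = [::] ->
    forall x, x \in W -> word_eval gen x = 1%g.
  by move/(_ _ _ w_nil erefl w); apply; rewrite inE.
move=> W W'; elim/reach_ind => [x _ ->//|x y z _ xy _ IH] /IH.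
exact: word_eval_step.
Qed.

End Rewriting.

(** * The machine *)

(** In [Start] the input still lacks its final mark. [Carry a] holds in the finite control a letter
    taken from the front of a word and not yet put down at its end. *)
Inductive state (A : finType) := Start | Main | Carry of letter A | Accept.
Arguments Start {A}.
Arguments Main {A}.
Arguments Accept {A}.

Definition state_code A (q : state A) : option (option (option (letter A))) :=
  match q with
  | Start => None
  | Main => Some None
  | Accept => Some (Some None)
  | Carry a => Some (Some (Some a))
  end.

Definition state_decode A (x : option (option (option (letter A)))) : state A :=
  match x with
  | None => Start
  | Some None => Main
  | Some (Some None) => Accept
  | Some (Some (Some a)) => Carry a
  end.

Lemma state_codeK A : cancel (@state_code A) (@state_decode A).
Proof. by case. Qed.

HB.instance Definition _ (A : finType) :=
  Finite.copy (state A) (can_type (@state_codeK A)).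

(** A finite list of all words satisfying [elem_word], so that the commands indexed by them form a
    finite type. *)
Definition elem_words (A : finType) (R : seq (word A)) : seq (word A) :=
  [seq [:: a; inv_letter a] | a <- enum (letter A)] ++ R ++ map (@inv_word A) R.

Lemma elem_wordsP (A : finType) (R : seq (word A)) e :
  reflect (elem_word R e) (e \in elem_words R).
Proof.
rewrite !mem_cat; apply: (iffP or3P) => [[/mapP[a _ ->]|eR|/mapP[r rR ->]]|].
- exact: elem_cancel.
- exact: elem_relator.
- exact: elem_relator_inv.
- case=> [a|r rR|r rR]; first by constructor 1; apply: map_f; rewrite mem_enum.
    by constructor 2.
  by constructor 3; apply: map_f.
Qed.

Section Machine.
Variables (A : finType) (R : seq (word A)).

(* [None] is the mark that terminates each word on the tape. *)
Notation symbol := (option (letter A)).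
Notation config := (tape_config symbol (state A)).

(** The symbol given to [Insert], [Remove] and [Split] is read to the right of the place of change
    and kept there; it excludes any change beyond the last mark, where no word is. *)
Inductive command :=
| MoveRight of symbol
| MoveLeft of symbol
| Insert of seq_sub (elem_words R) & symbol
| Remove of seq_sub (elem_words R) & symbol
| Split of symbol
| Discard of bool
| PickUp of bool & letter A
| Transport of letter A & letter A
| Drop of letter A
| Begin
| Finish of bool.

Definition command_code (t : command) :=
  match t with
  | MoveRight z => inl (inl (inl z))
  | MoveLeft z => inl (inl (inr z))
  | Insert e z => inl (inr (inl (e, z)))
  | Remove e z => inl (inr (inr (e, z)))
  | Split z => inr (inl (inl z))
  | Discard b => inr (inl (inr (inl b)))
  | PickUp b a => inr (inl (inr (inr (b, a))))
  | Transport a b => inr (inr (inl (inl (a, b))))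
  | Drop a => inr (inr (inl (inr a)))
  | Begin => inr (inr (inr (inl tt)))
  | Finish b => inr (inr (inr (inr b)))
  end.

Definition command_decode x : command :=
  match x with
  | inl (inl (inl z)) => MoveRight z
  | inl (inl (inr z)) => MoveLeft z
  | inl (inr (inl (e, z))) => Insert e z
  | inl (inr (inr (e, z))) => Remove e z
  | inr (inl (inl z)) => Split z
  | inr (inl (inr (inl b))) => Discard b
  | inr (inl (inr (inr (b, a)))) => PickUp b a
  | inr (inr (inl (inl (a, b)))) => Transport a b
  | inr (inr (inl (inr a))) => Drop a
  | inr (inr (inr (inl tt))) => Begin
  | inr (inr (inr (inr b))) => Finish b
  end.

Lemma command_codeK : cancel command_code command_decode.
Proof. by case. Qed.

HB.instance Definition _ := Finite.copy command (can_type command_codeK).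

(* A word begins at the left end of the tape or after a mark. *)
Definition left_guard (b : bool) : seq symbol := if b then [::] else [:: None].

Definition main_command (l r : seq symbol) (l' r' : seq symbol) :=
  TapeCommand false false (TapeConfig l (@Main A) r) (TapeConfig l' (@Main A) r').

Definition action (t : command) : tape_command symbol (state A) :=
  match t with
  | MoveRight z => main_command [::] [:: z] [:: z] [::]
  | MoveLeft z => main_command [:: z] [::] [::] [:: z]
  | Insert e z => main_command [::] [:: z] [::] (map Some (ssval e) ++ [:: z])
  | Remove e z => main_command [::] (map Some (ssval e) ++ [:: z]) [::] [:: z]
  | Split z => main_command [::] [:: z] [::] [:: None; z]
  | Discard b =>
      TapeCommand b false (TapeConfig (left_guard b) Main [:: None])
        (TapeConfig (left_guard b) Main [::])
  | PickUp b a =>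
      TapeCommand b false (TapeConfig (left_guard b) Main [:: Some a])
        (TapeConfig (left_guard b) (Carry a) [::])
  | Transport a b =>
      TapeCommand false false (TapeConfig [::] (Carry a) [:: Some b])
        (TapeConfig [:: Some b] (Carry a) [::])
  | Drop a =>
      TapeCommand false false (TapeConfig [::] (Carry a) [:: None])
        (TapeConfig [:: Some a] Main [:: None])
  | Begin =>
      TapeCommand false false (TapeConfig [::] Start [::])
        (TapeConfig [:: None] Main [::])
  | Finish b =>
      TapeCommand true true (TapeConfig [::] (if b then Start else Main) [::])
        (TapeConfig [::] Accept [::])
  end.

Lemma tape_sizeE u (q : state A) v :
  tape_size (TapeConfig u q v : config) = size (u ++ v).
Proof. by rewrite size_cat. Qed.

Definition idle_command : tape_command symbol (state A) :=
  TapeCommand false false (TapeConfig [::] Accept [::]) (TapeConfig [::] Accept [::]).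

(** The second tape starts in [Accept] and every command leaves it there, so acceptance is decided
    on the first tape alone. *)
Definition word_machine : turing_machine (letter A) 2 :=
  @TuringMachine (letter A) 2 (fun=> symbol) (fun=> state A) ord0 Some (@Some_inj _)
    command (fun t i => if i == ord0 then action t else idle_command)
    (fun i => if i == ord0 then Start else Accept) (fun=> Accept).

Definition step1 (c d : config) : Prop := exists t, tape_step (action t) c d.

Lemma tm_step1 (c d : tm_config word_machine) : tm_step c d -> step1 (c ord0) (d ord0).
Proof. by case=> t /(_ ord0) /= ?; exists t. Qed.

Definition lift_config (c : config) : tm_config word_machine :=
  fun i => if i == ord0 then c else TapeConfig [::] Accept [::].

Lemma tm_space_lift c : tm_space (lift_config c) = tape_size c.
Proof. by rewrite /tm_space big_ord_recl big_ord1 /= addn0. Qed.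

Lemma step1_lift c d : step1 c d -> tm_step (lift_config c) (lift_config d).
Proof.
case=> t cd; exists t => i; rewrite /= /lift_config; case: eqP => // _.
by exists [::], [::].
Qed.

(** * Sequences of words on the tape *)

(** Marks terminate words rather than separate them, which distinguishes the empty sequence from a
    single empty word. *)
Definition enc (W : seq (word A)) : seq symbol :=
  flatten [seq rcons (map Some w) None | w <- W].

Lemma enc_cons w W : enc (w :: W) = map Some w ++ None :: enc W.
Proof. by rewrite /enc /= cat_rcons. Qed.

Lemma enc_cat W1 W2 : enc (W1 ++ W2) = enc W1 ++ enc W2.
Proof. by rewrite /enc map_cat flatten_cat. Qed.

Lemma size_enc W : size (enc W) = seq_length W + size W.
Proof.
elim: W => [|w W IHW]; first by rewrite /seq_length big_nil.
by rewrite enc_cons size_cat size_map /= IHW /seq_length big_cons /=; lia.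
Qed.

Lemma seq_length_cat (W1 W2 : seq (word A)) :
  seq_length (W1 ++ W2) = seq_length W1 + seq_length W2.
Proof. by rewrite /seq_length big_cat. Qed.

Lemma enc_eq0 W : enc W = [::] -> W = [::].
Proof. by case: W => // w W; rewrite enc_cons; case: w. Qed.

Lemma last_enc W : last None (enc W) = None.
Proof. by elim/last_ind: W => // W w _; rewrite -cats1 enc_cat enc_cons !last_cat. Qed.

(** As [t] is not empty, the cut lies before some mark, hence within the word which that mark
    terminates; a cut just after a mark counts as the beginning of the next word. *)
Lemma enc_split W s t : enc W = s ++ t -> t != [::] ->
  exists W1 w1 w2 W2, [/\ W = W1 ++ (w1 ++ w2) :: W2, s = enc W1 ++ map Some w1 &
    t = map Some w2 ++ None :: enc W2].
Proof.
move=> eqW t_neq0; elim: s W eqW => [|y s IHs] [|w W]; rewrite ?enc_cons //.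
- by move=> /= t0; rewrite -t0 in t_neq0.
- by move=> /= <-; exists [::], [::], w, W.
case: w => [|b w] /= [<- eq_t].
  have [W1 [w1 [w2 [W2 [-> -> ->]]]]] := IHs _ eq_t.
  by exists ([::] :: W1), w1, w2, W2; rewrite enc_cons.
rewrite -enc_cons in eq_t.
have [[|w' W1] [w1 [w2 [W2 []]]]] := IHs _ eq_t; rewrite ?enc_cons => -[-> ->] -> ->.
  by exists [::], (b :: w1), w2, W2.
by exists ((b :: w') :: W1), w1, w2, W2; rewrite enc_cons.
Qed.

(** The default value of [last] lets the left end of the tape count as a mark, so that one
    hypothesis covers both ways for a word to begin. *)
Lemma enc_boundary W s t : enc W = s ++ t -> last None s = None ->
  exists W1 W2, [/\ W = W1 ++ W2, s = enc W1 & t = enc W2].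
Proof.
case: t => [|z t] eqW s_last.
  by exists W, [::]; rewrite eqW !cats0.
have [W1 [w1 [w2 [W2 [-> s_eq ->]]]]] := enc_split eqW isT.
move: s_last; rewrite s_eq; case/lastP: w1 {s_eq} => [_|w1 b].
  by exists W1, (w2 :: W2); rewrite cats0 enc_cons.
by rewrite last_cat map_rcons last_rcons.
Qed.

Lemma enc_prefix (e w : word A) z y X : map Some e ++ z :: y = map Some w ++ None :: X ->
  exists2 w', w = e ++ w' & z :: y = map Some w' ++ None :: X.
Proof.
elim: e w => [|a e IHe] w; first by exists w.
by case: w => [|b w] //= [-> /IHe[w' -> ->]]; exists w'.
Qed.

Lemma last_left_guard (b : bool) (x : seq symbol) :
  (b -> x = [::]) -> last None (x ++ left_guard b) = None.
Proof. by case: b => [->|_] //; rewrite last_cat. Qed.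

Lemma left_guardP (s : seq symbol) : last None s = None ->
  exists (b : bool) x, (b -> x = [::]) /\ s = x ++ left_guard b.
Proof.
case/lastP: s => [_|s z]; first by exists true, [::].
by rewrite last_rcons => ->; exists false, s; rewrite cats1.
Qed.

(** * From computations to rewritings *)

(** A carried letter is still counted at the front of its word, so the sequence changes only when it
    is dropped, and then by one cyclic shift. *)
Definition encodes (c : config) (W : seq (word A)) : Prop :=
  match tape_state c with
  | Start => exists w, [/\ W = [:: w], tape_left c = map Some w & tape_right c = [::]]
  | Main => tape_left c ++ tape_right c = enc W
  | Carry a => exists W1 w1 w2 W2, [/\ W = W1 ++ (a :: w1 ++ w2) :: W2,
      tape_left c = enc W1 ++ map Some w1 &
      tape_right c = map Some w2 ++ None :: enc W2]
  | Accept => W = [::]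
  end.

Lemma encodes_weight c W : encodes c W -> seq_length W <= tape_size c + 1.
Proof.
case: c => u [||a|] v; rewrite /encodes /tape_size /=.
- by case=> w [-> -> ->]; rewrite size_map /seq_length big_seq1 /=; lia.
- by rewrite -size_cat => ->; rewrite size_enc; lia.
- case=> W1 [w1 [w2 [W2 [-> -> ->]]]].
  rewrite !size_cat /= !size_enc !size_map seq_length_cat /seq_length big_cons /=.
  by rewrite size_cat; lia.
- by move=> ->; rewrite /seq_length big_nil.
Qed.

Lemma encodes_step c d W : step1 c d -> encodes c W ->
  exists2 W', encodes d W' & W = W' \/ elem_step R W W'.
Proof.
have elem_e (e : seq_sub (elem_words R)) : elem_word R (ssval e).
  exact/elem_wordsP/(valP e).
case=> t [x [y []]].
case: t => [z|z|e z|e z|z|b|b a|a b|a||[]] /=; rewrite ?cats0 => xP yP -> ->;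
  rewrite /encodes /=.
- by exists W; [rewrite -catA|left].
- by exists W; [rewrite -catA in H *|left].
- move/esym/enc_split => /(_ isT)[W1 [w1 [w2 [W2 [-> -> zE]]]]].
  exists (W1 ++ (w1 ++ ssval e ++ w2) :: W2).
    by rewrite -!catA /= zE enc_cat enc_cons !map_cat -!catA.
  by right; apply: (ElemStep W1 W2 (elem_insert _ _ (elem_e e))).
- move=> /esym/enc_split[|W1 [w1 [w2 [W2 [-> ->]]]]].
    by case: (ssval e).
  rewrite -catA => /enc_prefix[w2' -> zE].
  exists (W1 ++ (w1 ++ w2') :: W2).
    by rewrite /= zE enc_cat enc_cons !map_cat -!catA.
  by right; apply: (ElemStep W1 W2 (elem_remove _ _ (elem_e e))).
- move/esym/enc_split => /(_ isT)[W1 [w1 [w2 [W2 [-> -> zE]]]]].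
  exists (W1 ++ [:: w1; w2] ++ W2).
    by rewrite /= zE enc_cat !enc_cons -!catA.
  by right; apply: (ElemStep W1 W2 (elem_split _ _ _)).
(* The guard places the head at the beginning of a word, and the mark read next shows that this word
   is empty. *)
- move/esym/enc_boundary=> /(_ (last_left_guard xP))[W1 [[|w W2] [-> ->]]] //.
  rewrite enc_cons; case: w => [[->]|//]; exists (W1 ++ W2); first by rewrite enc_cat.
  by right; apply: (ElemStep W1 W2 (elem_discard _)).
- move/esym/enc_boundary=> /(_ (last_left_guard xP))[W1 [[|w W2] [-> ->]]] //.
  rewrite enc_cons; case: w => [//|_ w [<- ->]].
  exists (W1 ++ (a :: w) :: W2); last by left.
  by exists W1, [::], w, W2; rewrite cats0.
- case=> W1 [w1 [[|b' w2] [W2 [-> -> [//]]]]] => <- ->.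
  exists (W1 ++ (a :: w1 ++ b :: w2) :: W2); last by left.
  exists W1, (w1 ++ [:: b]), w2, W2; split=> //; first by rewrite -catA.
  by rewrite map_cat catA.
- case=> W1 [w1 [[|b' w2] [W2 [-> -> [//]]]]] ->; rewrite cats0.
  exists (W1 ++ (w1 ++ [:: a]) :: W2); first by rewrite enc_cat enc_cons map_cat -!catA.
  by right; apply: (ElemStep W1 W2 (elem_shift _ [:: a] w1)).
- case=> w [-> -> ->]; exists [:: w]; last by left.
  by rewrite enc_cons -catA.
(* [Finish true] sees both ends of the tape, so the input is empty and accepting it amounts to
   discarding one empty word. *)
- case=> w []; rewrite (xP isT) (yP isT) => -> /esym/(congr1 size).
  rewrite size_map => /size0nil -> _; exists [::] => //; right.
  exact: (ElemStep [::] [::] (elem_discard _)).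
- by rewrite (xP isT) (yP isT) => /esym/enc_eq0 ->; exists [::]; [|left].
Qed.

(** * From rewritings to computations *)

Notation reach1 := (reach step1 (@tape_size _ _)).

(** The head is brought back to the left end before and after, so that transformations of the tape
    compose whatever place each one acts on. *)
Definition tape_reach (B : nat) (T T' : seq symbol) : Prop :=
  reach1 B (TapeConfig [::] Main T) (TapeConfig [::] Main T').

Lemma reach_move B u v u' v' : size (u ++ v) <= B -> u ++ v = u' ++ v' ->
  reach1 B (TapeConfig u Main v) (TapeConfig u' Main v').
Proof.
move=> uvB uvE; apply: (@reach_trans _ _ _ _ _ (TapeConfig [::] Main (u ++ v))).
  elim/last_ind: u v uvB {u' v' uvE} => [|u z IHu] v uvB; first exact: reach_refl.
  have uvB' : size (u ++ z :: v) <= B by rewrite -cat_rcons.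
  rewrite cat_rcons; apply: reach_cons (IHu _ uvB'); first by rewrite tape_sizeE.
  by exists (MoveLeft z), u, v; rewrite /= cats1 cats0.
rewrite {}uvE in uvB *; elim/last_ind: u' v' uvB => [|u' z IHu] v' uvB.
  exact: reach_refl.
have uvB' : size (u' ++ z :: v') <= B by rewrite -cat_rcons.
rewrite cat_rcons; apply: reach_trans (IHu _ uvB') _.
apply: reach_step; rewrite ?tape_sizeE //.
by exists (MoveRight z), u', v'; rewrite /= cats1 cats0.
Qed.

Lemma tape_reach_refl B T : size T <= B -> tape_reach B T T.
Proof. by move=> TB; apply: reach_move. Qed.

Lemma tape_reach_trans B T1 T2 T3 :
  tape_reach B T1 T2 -> tape_reach B T2 T3 -> tape_reach B T1 T3.
Proof. exact: reach_trans. Qed.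

Lemma reach_tape_reach B u v u' v' :
    size (u ++ v) <= B -> size (u' ++ v') <= B ->
  reach1 B (TapeConfig u Main v) (TapeConfig u' Main v') ->
  tape_reach B (u ++ v) (u' ++ v').
Proof.
move=> uvB uvB' uv; apply: reach_trans (reach_trans uv _); exact: reach_move.
Qed.

Lemma tape_reach_replace B x e e' z y :
    size (x ++ e ++ z :: y) <= B -> size (x ++ e' ++ z :: y) <= B ->
    (exists t, action t = main_command [::] (e ++ [:: z]) [::] (e' ++ [:: z])) ->
  tape_reach B (x ++ e ++ z :: y) (x ++ e' ++ z :: y).
Proof.
move=> eB e'B [t tE]; apply: reach_tape_reach => //.
apply: reach_step; rewrite ?tape_sizeE //.
by exists t, x, y; rewrite tE /= cats0 -!catA.
Qed.

Lemma tape_reach_discard B P S : last None P = None ->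
  size (P ++ None :: S) <= B -> tape_reach B (P ++ None :: S) (P ++ S).
Proof.
move=> /left_guardP[b [x [xP ->]]] B1.
have B2 : size ((x ++ left_guard b) ++ S) <= B.
  by apply: leq_trans B1; rewrite !size_cat /= leq_add2l.
apply: reach_tape_reach => //; apply: reach_step; rewrite ?tape_sizeE //.
by exists (Discard b), x, S; split=> //=.
Qed.

Lemma tape_reach_rot1 B P a w S : last None P = None ->
    size (P ++ enc [:: a :: w] ++ S) <= B ->
  tape_reach B (P ++ enc [:: a :: w] ++ S) (P ++ enc [:: rcons w a] ++ S).
Proof.
move=> P_last.
have -> : P ++ enc [:: a :: w] ++ S = P ++ Some a :: map Some w ++ None :: S.
  by rewrite enc_cons -catA.
have -> : P ++ enc [:: rcons w a] ++ S = (P ++ map Some w ++ [:: Some a]) ++ None :: S.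
  by rewrite enc_cons map_rcons -cats1 -!catA.
move=> TB; apply: reach_tape_reach => //.
  by move: TB; rewrite !size_cat /= !size_cat /=; lia.
(* Here [w1] is already passed and [w2] still ahead. While the letter is carried the tape is one
   cell shorter; the strict bound below reserves that cell for dropping it. *)
have carry w1 w2 : w = w1 ++ w2 ->
    reach1 B (TapeConfig (P ++ map Some w1) (Carry a) (map Some w2 ++ None :: S))
             (TapeConfig (P ++ map Some w ++ [:: Some a]) Main (None :: S)).
  move=> wE; have wB : tape_size (TapeConfig (P ++ map Some w1) (Carry a)
      (map Some w2 ++ None :: S)) < B.
    move: TB; rewrite tape_sizeE wE map_cat !size_cat /= !size_cat /=; lia.
  elim: w2 w1 wE wB => [|b w2 IHw] w1 wE wB.
    apply: reach_step; first exact: ltnW.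
      apply: leq_trans wB; rewrite !tape_sizeE wE cats0 !size_cat /=; lia.
    by exists (Drop a), (P ++ map Some w1), S; split; rewrite //= ?cats0 // wE cats0 catA.
  apply: (reach_cons (ltnW wB)); last first.
    apply: (IHw (rcons w1 b)); first by rewrite cat_rcons.
    by move: wB; rewrite !tape_sizeE map_rcons !size_cat size_rcons /=; lia.
  exists (Transport a b), (P ++ map Some w1), (map Some w2 ++ None :: S).
  by split; rewrite //= ?cats0 // map_rcons -cats1 catA.
have [b [x [xP PE]]] := left_guardP P_last.
apply: (@reach_cons _ _ _ _ _ (TapeConfig P (Carry a) (map Some w ++ None :: S))).
- by rewrite tape_sizeE.
- by rewrite PE; exists (PickUp b a), x, (map Some w ++ None :: S); split.
by have := carry [::] w erefl; rewrite cats0.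
Qed.

Lemma tape_reach_rot B P u v S : last None P = None ->
    size (P ++ enc [:: u ++ v] ++ S) <= B ->
  tape_reach B (P ++ enc [:: u ++ v] ++ S) (P ++ enc [:: v ++ u] ++ S).
Proof.
move=> P_last; elim: u v => [|a u IHu] v TB.
  by rewrite cats0; apply: tape_reach_refl.
apply: tape_reach_trans (tape_reach_rot1 P_last TB) _.
rewrite rcons_cat -(cat_rcons a v u); apply: IHu.
move: TB; rewrite !(size_cat P) !(size_cat (enc _)) !size_enc.
by rewrite /seq_length !big_seq1 !size_cat size_rcons /=; lia.
Qed.

Lemma tape_reach_enc_replace B P w ws S : last None P = None ->
    elem_replace R w ws ->
    size (P ++ enc [:: w] ++ S) <= B -> size (P ++ enc ws ++ S) <= B ->
  tape_reach B (P ++ enc [:: w] ++ S) (P ++ enc ws ++ S).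
Proof.
move=> P_last w_ws.
have elem_e e : elem_word R e -> e \in elem_words R by move/elem_wordsP.
have split_enc u v : P ++ enc [:: u ++ v] ++ S =
    (P ++ map Some u) ++ map Some v ++ None :: S.
  by rewrite enc_cons map_cat -!catA.
(* The terminating mark guarantees the symbol that the commands must read. *)
have headE (v : word A) : exists z y, map Some v ++ None :: S = z :: y.
  by case: v => [|c v]; [exists None, S | exists (Some c), (map Some v ++ None :: S)].
case: w_ws => {w ws} [u v e eR|u v e eR|u v|u v|] B1 B2.
- have [z [y zE]] := headE v.
  move: B1 B2; rewrite !split_enc map_cat -(catA (map Some e)) zE => B1 B2.
  apply: (@tape_reach_replace B _ [::] (map Some e)) => //.
  by exists (Insert (SeqSub (elem_e _ eR)) z).
- have [z [y zE]] := headE v.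
  move: B1 B2; rewrite !split_enc map_cat -(catA (map Some e)) zE => B1 B2.
  apply: (@tape_reach_replace B _ (map Some e) [::]) => //.
  by exists (Remove (SeqSub (elem_e _ eR)) z).
- exact: tape_reach_rot.
- have [z [y zE]] := headE v.
  have uvE : P ++ enc [:: u; v] ++ S = (P ++ map Some u) ++ [:: None] ++ z :: y.
    by rewrite !enc_cons -zE -!catA /= -catA.
  move: B1 B2; rewrite uvE split_enc zE => B1 B2.
  apply: (@tape_reach_replace B _ [::] [:: None]) => //.
  by exists (Split z).
- exact: tape_reach_discard.
Qed.

(** * Imitation of rewritings on tapes without empty words *)

Definition nonempty_words (W : seq (word A)) : seq (word A) :=
  [seq w <- W | ~~ nilp w].

Notation tape W := (enc (nonempty_words W)).

(** Each remaining word has a letter to pay for its mark. *)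
Lemma size_tape W : size (tape W) <= (seq_length W).*2.
Proof.
elim: W => // w W; rewrite /seq_length big_cons -/(seq_length W) /nonempty_words.
case: w => [|a w]; rewrite [filter _ (_ :: _)]/= ?enc_cons -/(nonempty_words W) => IHW.
  exact: IHW.
by move: (enc _) IHW => T; rewrite size_cat size_map /= doubleD; lia.
Qed.

(* The empty word is split off a neighbour, hence the tape must not be empty. *)
Lemma tape_reach_fill B P w S : last None P = None ->
    P ++ tape [:: w] ++ S != [::] -> size (P ++ enc [:: w] ++ S) <= B ->
  tape_reach B (P ++ tape [:: w] ++ S) (P ++ enc [:: w] ++ S).
Proof.
case: w => [|a w] P_last; last by move=> _; apply: tape_reach_refl.
rewrite enc_cons /=; case: S => [|z S].
  (* With nothing to the right, the last mark of the prefix serves as the symbol to read: a mark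
     inserted before it gives the same tape as one appended after it. *)
  case/lastP: P P_last => [|P z] //; rewrite last_rcons => -> _ B1.
  rewrite cats0 -cats1 -catA.
  apply: (@tape_reach_replace B P [::] [:: None] None [::]).
  - by apply: leq_trans B1; rewrite !size_cat size_rcons /=; lia.
  - by apply: leq_trans B1; rewrite !size_cat size_rcons /=; lia.
  - by exists (Split None).
move=> _ B1; apply: (@tape_reach_replace B P [::] [:: None]) => //.
  by apply: leq_trans B1; rewrite !size_cat /=; lia.
by exists (Split z).
Qed.

(** Empty words are discarded from left to right; a nonempty word joins the prefix [P], which again
    ends with a mark. *)
Lemma tape_reach_clean B P ws S : last None P = None ->
    size (P ++ enc ws ++ S) <= B ->
  tape_reach B (P ++ enc ws ++ S) (P ++ tape ws ++ S).
Proof.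
elim: ws P => [|w ws IHws] P P_last; first exact: tape_reach_refl.
rewrite enc_cons; case: w => [|a w] TB;
  rewrite /nonempty_words [filter _ (_ :: _)]/= ?enc_cons -/(nonempty_words ws).
  apply: tape_reach_trans (tape_reach_discard P_last TB) (IHws _ P_last _).
  by move: TB; move: (enc ws) => T; rewrite !size_cat /=; lia.
have catE X : P ++ (map Some (a :: w) ++ None :: X) ++ S =
    rcons (P ++ map Some (a :: w)) None ++ X ++ S by rewrite cat_rcons -!catA.
by rewrite !catE in TB *; apply: IHws => //; rewrite last_rcons.
Qed.

(** The word acted on is restored if it is empty, the transformation is imitated, and the empty
    words it produced are discarded. *)
Lemma tape_reach_step s W W' : elem_step R W W' -> tape W != [::] ->
    seq_length W <= s -> seq_length W' <= s ->
  tape_reach (s.*2 + 2) (tape W) (tape W').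
Proof.
case=> W1 w ws W2 w_ws; rewrite -cat1s /nonempty_words !filter_cat !enc_cat.
rewrite !seq_length_cat => W_neq0 Ws W's.
(* Only [V] may contain empty words, and a transformation yields at most two words (a splitting),
   whence the summand 2. *)
have size_le V : size V <= 2 -> seq_length W1 + (seq_length V + seq_length W2) <= s ->
    size (tape W1 ++ enc V ++ tape W2) <= s.*2 + 2.
  rewrite (size_cat (tape W1)) (size_cat (enc V)) (size_enc V).
  by have := (size_tape W1, size_tape W2); case; lia.
have B1 := size_le [:: w] isT Ws.
have B2 : size (tape W1 ++ enc ws ++ tape W2) <= s.*2 + 2.
  by apply: size_le W's; case: (w_ws).
have W1_last := last_enc (nonempty_words W1).
apply: tape_reach_trans (tape_reach_fill W1_last W_neq0 B1) _.
apply: tape_reach_trans (tape_reach_clean W1_last B2).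
exact: tape_reach_enc_replace.
Qed.

(* Once no letter is left the machine accepts: it cannot create a word from
   nothing, so it does not follow the rewriting any further. *)
Lemma reach_accept s W : reach (elem_step R) (@seq_length A) s W [::] ->
  reach1 (s.*2 + 2) (TapeConfig [::] Main (tape W)) (TapeConfig [::] Accept [::]).
Proof.
have accept0 B : reach1 B (TapeConfig [::] Main [::]) (TapeConfig [::] Accept [::]).
  by apply: reach_step => //; exists (Finish false), [::], [::].
have: [::] = [::] :> seq (word A) by [].
move: {1 3}[::] => W' W'0 WW'; elim/reach_ind: WW' W'0 => [x _ ->|x y z xs xy yz IH z0].
  exact: accept0.
have [->|x_neq0] := eqVneq (tape x) [::]; first exact: accept0.
apply: reach_trans (IH z0).
exact: tape_reach_step xy x_neq0 xs (reach_weight yz).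
Qed.

(** The bound 0 for the empty word matters at [n = 0], where the linear term of the equivalence
    vanishes. *)
Lemma reach_start w s : reach (elem_step R) (@seq_length A) s [:: w] [::] ->
  reach1 (if nilp w then 0 else s.*2 + 2)
    (TapeConfig (map Some w) Start [::]) (TapeConfig [::] Accept [::]).
Proof.
case: w => [_|a w ws]; first by apply: reach_step => //; exists (Finish true), [::], [::].
have w_s : size (a :: w) <= s by have := reach_weight ws; rewrite /seq_length big_seq1.
apply: (@reach_cons _ _ _ _ _ (TapeConfig (enc [:: a :: w]) Main [::])).
- by rewrite tape_sizeE cats0 size_map; lia.
- by exists Begin, (map Some (a :: w)), [::]; split; rewrite ?enc_cons ?cats0.
apply: reach_trans (reach_accept ws); apply: reach_move; last by rewrite cats0.
by rewrite cats0 size_enc /seq_length big_seq1 [size [:: _]]/=; lia.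
Qed.

Lemma tm_reach_start w s : reach (elem_step R) (@seq_length A) s [:: w] [::] ->
  reach (@tm_step _ _ word_machine) (@tm_space _ _ word_machine)
    (if nilp w then 0 else s.*2 + 2) (lift_config (TapeConfig (map Some w) Start [::]))
    (lift_config (TapeConfig [::] Accept [::])).
Proof.
move=> /reach_start wA.
have [||y -> ] := @reach_simulation _ _ _ _ (@tm_step _ _ word_machine)
  (@tm_space _ _ word_machine) (fun c c' => c' = lift_config c) 0 _ _ _ _ _ _ wA erefl.
- by move=> c c' ->; rewrite tm_space_lift addn0.
- by move=> c d c' /step1_lift cd ->; exists (lift_config d); [|right].
by rewrite addn0.
Qed.

Lemma input_lift_config w :
  @is_input_config _ _ word_machine w (lift_config (TapeConfig (map Some w) Start [::])).
Proof. by split=> [|i i0]; rewrite /lift_config //= (negbTE i0). Qed.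

Lemma lift_accepting :
  @tm_accepting _ _ word_machine (lift_config (TapeConfig [::] Accept [::])).
Proof. by move=> i; rewrite /lift_config; case: ifP. Qed.

End Machine.

(** * The space functions *)

Section SpaceFunctions.
Variables (G : groupType) (A : finType) (R : seq (word A)) (gen : A -> G).
Hypothesis hG : is_presentation R gen.

(** The simulation by [encodes] on the first tape; in an accepting configuration it leaves only the
    empty sequence. *)
Lemma tm_reach_rewrite w (c : tm_config (word_machine R)) p :
    is_input_config w c ->
    is_run (@tm_step _ _ (word_machine R)) (@tm_accepting _ _ (word_machine R)) c p ->
  reach (elem_step R) (@seq_length A) (run_space (@tm_space _ _ (word_machine R)) c p + 1)
    [:: w] [::].
Proof.
move=> [c_in _] [p_path p_acc].
have cp : reach (@tm_step _ _ (word_machine R)) (@tm_space _ _ (word_machine R))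
    (run_space (@tm_space _ _ (word_machine R)) c p) c (last c p) by exists p.
have [|||W WE] := @reach_simulation _ _ _ _ (elem_step R) (@seq_length A)
  (fun c : tm_config (word_machine R) => encodes (c ord0)) 1 _ _ _ _ _ [:: w] cp.
- move=> d W /encodes_weight/leq_trans; apply.
  by rewrite leq_add2r /tm_space big_ord_recl leq_addr.
- move=> d d' W /tm_step1 dd'; exact: encodes_step dd'.
- by rewrite c_in /encodes /=; exists w.
by move: WE; rewrite /encodes (p_acc ord0) /= => ->.
Qed.

Lemma word_machine_accepts w : tm_accepts (word_machine R) w <-> word_eval gen w = 1%g.
Proof.
rewrite (word_eval1P hG); split=> [[c [p [c_in c_p]]]|[B /tm_reach_start[p [p_path _ pE]]]].
  by eexists; apply: tm_reach_rewrite c_in c_p.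
exists (lift_config R (TapeConfig (map Some w) Start [::])), p.
by split; [exact: input_lift_config | split=> //; rewrite pE; exact: lift_accepting].
Qed.

(** For a nonempty word [size w] absorbs the unit lost to the carried letter; the empty word is
    discarded in space 0. *)
Lemma word_space_le w : word_eval gen w = 1%g ->
  word_space R w <= tm_word_space (word_machine R) w + size w.
Proof.
case: w => [|a w] w1.
  apply: (@min_space_le _ _ _ _ _ _ [::]) => //.
  apply: reach_step; rewrite /seq_length ?big_seq1 ?big_nil //.
  exact: (@ElemStep _ _ [::] _ _ [::] (elem_discard R)).
have [c [p [c_in c_p]]] := (word_machine_accepts (a :: w)).2 w1.
have [|d [q [d_in d_q dE]]] := @least_in (fun s => exists c p,
  [/\ @is_input_config _ _ (word_machine R) (a :: w) c,
      is_run (@tm_step _ _ _) (@tm_accepting _ _ _) c p &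
      s = run_space (@tm_space _ _ _) c p]).
  by exists (run_space (@tm_space _ _ _) c p), c, p.
rewrite /tm_word_space dE.
apply: (@min_space_le _ _ _ _ _ _ [::]) => //.
by apply: reach_le (tm_reach_rewrite d_in d_q); rewrite leq_add2l.
Qed.

(** The summand 2 of the bound $2s+2$ is absorbed by twice the length of a nonempty word. *)
Lemma tm_word_space_le w : word_eval gen w = 1%g ->
  tm_word_space (word_machine R) w <= (word_space R w + size w).*2.
Proof.
move=> /(word_eval1P hG)[B [p [p_path _ p_nil]]].
have [|W -> /tm_reach_start[q [q_path qB qE]]] :=
    @min_space_reach _ (elem_step R) (@seq_length A) (fun W => W = [::]) [:: w] p.
  by [].
apply: (@leq_trans (run_space (@tm_space _ _ _)
    (lift_config R (TapeConfig (map Some w) Start [::])) q)).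
  apply: least_le; exists (lift_config R (TapeConfig (map Some w) Start [::])), q.
  split=> //; first exact: input_lift_config.
  by split=> //; rewrite qE; exact: lift_accepting.
apply: leq_trans qB _; rewrite -/(word_space R w).
by case: w {p_path p_nil q_path qE} => [|a w] //=; lia.
Qed.

End SpaceFunctions.

Lemma fpreceq_max (T : finType) (P : pred (seq T)) (F F' : seq T -> nat) c :
    (forall w, P w -> F w <= c * F' w + c * size w) ->
  fpreceq (fun n => \max_(w : n.-bseq T | P w) F w)
          (fun n => \max_(w : n.-bseq T | P w) F' w).
Proof.
move=> FF'; exists c.+1; split=> // n.
apply/bigmax_leqP => w Pw; have wn := size_bseq w.
(* The factor [c.+1] is positive even for [c = 0], so [w] itself competes in the maximum over words
   of length at most [c.+1 * n]. *)
have wcn : size w <= c.+1 * n by rewrite mulSn; lia.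
have le_F' : F' w <= \max_(w : (c.+1 * n).-bseq T | P w) F' w.
  exact: (leq_bigmax_cond (Bseq wcn)).
apply: leq_trans (FF' _ Pw) _; apply: leq_add; rewrite leq_mul //.
Qed.

Theorem proposition1p1 (G : groupType) (A : finType) (R : seq (word A))
    (gen : A -> G) (hG : is_presentation R gen) :
  exists M : turing_machine (letter A) 2,
    fequiv (tm_space_function M) (group_space_function R gen) /\
    (forall w : word A, tm_accepts M w <-> word_eval gen w = 1%g).
Proof.
exists (word_machine R); split; last exact: word_machine_accepts.
have accE w : `[< tm_accepts (word_machine R) w >] = `[< word_eval gen w = 1%g >].
  by apply/asbool_equiv_eq/word_machine_accepts.
(* Since the accepted words are those equal to 1, both maxima range over the same words and can be
   compared word by word. *)
have tmE : tm_space_function (word_machine R) = fun n =>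
    \max_(w : n.-bseq (letter A) | `[< word_eval gen w = 1%g >])
      tm_word_space (word_machine R) w.
  by apply/funext => n; apply: eq_bigl => w; exact: accE.
rewrite tmE; split.
  apply: (@fpreceq_max _ (fun w => `[< word_eval gen w = 1%g >]) _ _ 2).
  by move=> w /asboolP/(tm_word_space_le hG); rewrite -mulnDr mul2n.
apply: (@fpreceq_max _ (fun w => `[< word_eval gen w = 1%g >]) _ _ 1).
by move=> w /asboolP/(word_space_le hG); rewrite !mul1n.
Qed.
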